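(* With $M_n(c,\alpha,\beta)$ as defined in the context and $C_j=\frac1{j+1}\binom{2j}{j}$, the following hold, where ''the g.f. of $(a_n)_{n\ge0}$'' means $\sum_{n\ge 0}a_nx^n$. 1) The g.f. of $M_n(-1,1/2,3/2)$ is $\dfrac{1-\sqrt{(1-3x)/(1+x)}}{2x}$, the g.f. of the Riordan numbers; thus $M_n(-1,1/2,3/2)$ is the $n$-th Riordan number. 2) The g.f. of $M_n(-1,3/2,3/2)$ is $f(x)=\dfrac{1-x-\sqrt{1-2x-3x^2}}{2x^2}$, which satisfies $x^2f^2+(x-1)f+1=0$; thus $M_n(-1,3/2,3/2)$ is the $n$-th Motzkin number. 3) The g.f. of $2^nM_n(-1/2,1/2,3/2)$ is $A(x)=\dfrac{1-\sqrt{(1-7x)/(1+x)}}{4x}$, and it satisfies $A(x)=\dfrac{1}{1+x}+2xA(x)^2$. 4) The g.f. of $2^nM_n(-3/2,1/2,3/2)$ is $\dfrac{1-\sqrt{(1-5x)/(1+3x)}}{4x}$. 5) The g.f. of $2^nM_n(1/2,1/2,3/2)$ is $\dfrac{1-\sqrt{(1-9x)/(1-x)}}{4x}$; hence the sequence obtained from it by adjoining the number $1$ at the beginning has g.f. $\dfrac{5-\sqrt{(1-9x)/(1-x)}}{4}$. 6) $M_n(1,1/2,3/2)=\sum_{j=0}^n\binom nj C_j$ for all $n\ge0$, i.e. this sequence is the binomial transform of the Catalan numbers. 7) $M_n(1,3/2,1/2)=\sum_{j=0}^n\binom nj\binom{2j+1}{j+1}$ for all $n\ge 0$. 8) The g.f.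 of $2^nM_n(3/2,1/2,3/2)$ is $\dfrac{1-\sqrt{(1-11x)/(1-3x)}}{4x}$. 9) $M_n(2,1/2,3/2)$ is the second (i.e. twice iterated) binomial transform of the Catalan numbers, and its g.f. is $\dfrac{1-\sqrt{(1-6x)/(1-2x)}}{2x}$.
   Context: For $c\in\mathbb R$, $\alpha,\beta>0$ and integer $n\ge 0$, $$M_n(c,\alpha,\beta)=\int_c^{4+c}x^n\,\frac{(x-c)^{\alpha-1}(4+c-x)^{\beta-1}}{4^{\alpha+\beta-1}B(\alpha,\beta)}\,dx,$$ with $B$ the Beta function. All generating function identities are understood as identities of power series near $x=0$ (removable singularity at $x=0$), square roots being the branch with value $1$ at $x=0$. The binomial transform of $(a_n)$ is the sequence $b_n=\sum_{j=0}^n\binom nj a_j$. The Riordan numbers are the sequence with generating function $\frac{1-\sqrt{(1-3x)/(1+x)}}{2x}$. The Motzkin numbers are the coefficients of the unique power series $f$ with $x^2f^2+(x-1)f+1=0$. *)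

(* Defs.v *)
From HB Require Import structures.
From mathcomp Require Import all_boot all_order all_algebra.
From mathcomp Require Import all_classical all_reals all_analysis.

Set Implicit Arguments.
Unset Strict Implicit.
Unset Printing Implicit Defensive.

Import Order.TTheory GRing.Theory Num.Theory.
Import numFieldNormedType.Exports.

Local Open Scope classical_set_scope.
Local Open Scope ring_scope.

(* The library's [beta_fun] only takes natural parameters. The endpoint values
   of the integrands below are irrelevant, being on a null set. *)
Definition Beta (R : realType) (a b : R) : R :=
  \int[lebesgue_measure]_(x in `[0, 1]) (x `^ (a - 1) * (1 - x) `^ (b - 1)).

Definition moment (R : realType) (c alpha beta : R) (n : nat) : R :=
  \int[lebesgue_measure]_(x in `[c, 4 + c])
    (x ^+ n * ((x - c) `^ (alpha - 1) * (4 + c - x) `^ (beta - 1) /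
               (4 `^ (alpha + beta - 1) * Beta alpha beta))).

(* The power series [sum_n a_n x^n] has positive radius of convergence and sum
   [F] near 0. The neighbourhood is punctured because the closed forms for [F]
   have a removable singularity at 0; the value at 0 is then forced by
   continuity of the power series. [Num.sqrt] is the nonnegative root, hence
   the branch with value 1 at 0 for radicands equal to 1 at 0. *)
Definition has_gf (R : realType) (a : R^nat) (F : R -> R) : Prop :=
  \forall x \near 0^', pseries a x @ \oo --> F x.

Definition catalan (R : realType) (j : nat) : R :=
  (j.+1%:R)^-1 * 'C(2 * j, j)%:R.

Definition binomial_transform (R : realType) (a : R^nat) : R^nat :=
  fun n => \sum_(j < n.+1) 'C(n, j)%:R * a j.

Definition adjoin1 (R : realType) (a : R^nat) : R^nat :=
  fun n => if n is k.+1 then a k else 1.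

(* Definite description: a power series expansion at 0 is unique. *)
Definition riordan (R : realType) : R^nat :=
  get [set r : R^nat |
    has_gf r (fun x => (1 - Num.sqrt ((1 - 3 * x) / (1 + x))) / (2 * x))].

(* Formal power series are represented by their coefficient sequences; they are
   added pointwise, but their product is the Cauchy product. *)
Definition fps_mul (R : realType) (f g : R^nat) : R^nat :=
  fun n => \sum_(k < n.+1) f k * g (n - k)%N.
Definition fps_one (R : realType) : R^nat := fun n => (n == 0%N)%:R.
Definition fps_X (R : realType) : R^nat := fun n => (n == 1%N)%:R.

Definition motzkin_series (R : realType) (f : R^nat) : Prop :=
  let X := fps_X R in let one := fps_one R in
  forall n : nat,
    fps_mul (fps_mul X X) (fps_mul f f) n
    + fps_mul (fun k => X k - one k) f n + one n = 0.

(* Definite description: [motzkin_series] has exactly one solution. *)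
Definition motzkin (R : realType) : R^nat :=
  get [set f : R^nat | motzkin_series f].

(* Main.v *)
Require Import Defs.
From HB Require Import structures.
From mathcomp Require Import all_boot all_order all_algebra.
From mathcomp Require Import all_classical all_reals all_analysis.
From mathcomp Require Import measurable_realfun ring lra.

Set Implicit Arguments.
Unset Strict Implicit.
Unset Printing Implicit Defensive.

Import Order.TTheory GRing.Theory Num.Theory.
Import numFieldNormedType.Exports.
Local Open Scope classical_set_scope.
Local Open Scope ring_scope.

(** The substitution [x = c + 4 u] turns the moment of order [n] into the
    expectation of [(c + 4 U) ^ n] for a Beta distributed variable [U] on
    [[0, 1]] (lemma [momentE]).  Everything else is read off this formula.

    For [c = 0] the moment is [4 ^ n] times a ratio of Beta integrals, so the
    functional equation [Beta (a + 1) b = a / (a + b) * Beta a b] gives a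
    first-order recurrence in [n].  For the parameters (1/2, 3/2), (3/2, 3/2)
    and (3/2, 1/2) it is the recurrence of the Catalan numbers, of the Catalan
    numbers from index 1 on, and of ['C(2 n + 1, n + 1)].

    For the other values of [c], two consequences of the formula suffice.
    Expanding [(c + 1 + 4 U) ^ n] by the binomial theorem shows that replacing
    [c] by [c + 1] is a binomial transform.  Summing the geometric series under
    the integral shows that the generating function is the expectation of
    [1 / (1 - x (c + 4 U))]; factoring out [1 - c x] expresses it by the one for
    [c = 0] at [x / (1 - c x)] (lemma [has_gf_moment_translate]).

    It remains to sum the Catalan series.  Its sum [F] satisfies
    [F = 1 + x F ^ 2] because the Catalan numbers are their own convolution up
    to a shift, so [(1 - 2 x F) ^ 2 = 1 - 4 x], and [1 - 2 x F] is the positive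
    root because [F] tends to 1 at 0.  The same passage between identities of
    coefficients and identities of functions (Cauchy product [has_gfM] and
    uniqueness of expansions [has_gf0_coef]) proves that the moments for
    (3/2, 3/2) and [c = -1] solve the Motzkin equation as formal series. *)

(** * Improper integrals of nonnegative functions *)

Section ImproperFTC.
Context {R : realType}.
Local Notation mu := (@lebesgue_measure R).

(** The integrand may blow up at both end points.  The usual theorem applies on
    the segments [[a + e, b - e]], and for a nonnegative integrand monotone
    convergence lets [e] tend to 0.  In particular the integral is finite, which
    is how integrability is obtained below. *)
Lemma ge0_improper_FTC2 (f F : R -> R) (a b l r : R) : a < b ->
    {in `]a, b[, forall x, 0 <= f x} ->
    {in `]a, b[, continuous f} ->
    {in `]a, b[, forall x, is_derive x (1 : R) F (f x)} ->
    F x @[x --> a^'+] --> l -> F x @[x --> b^'-] --> r ->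
  (\int[mu]_(x in `[a, b]) (f x)%:E = (r - l)%:E)%E.
Proof.
move=> ab f0 cf dF Fl Fr.
(* The 3 keeps the segments nonempty from the first one on. *)
pose e n : R := (b - a) / n.+3%:R.
have e_gt0 n : 0 < e n by rewrite divr_gt0// subr_gt0.
have e_anti : {homo e : m n / (m <= n)%N >-> n <= m}.
  move=> m n mn; rewrite ler_pM2l ?subr_gt0// lef_pV2 ?posrE//.
  by rewrite ler_nat !ltnS.
have e_mid n : a + e n < b - e n.
  have : e n <= (b - a) / 3 by have := e_anti 0%N n (leq0n n).
  by lra.
have e_cvg : e n @[n --> \oo] --> (0 : R).
  rewrite -[X in _ --> X](mulr0 (b - a)); apply: cvgMl_tmp.
  have := @cvg_harmonic R; rewrite -(cvg_shiftn 2) /=.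
  by apply: cvg_trans; apply: near_eq_cvg; near=> n; rewrite /= addn2.
pose S n := `[a + e n, b - e n]%classic.
have S_sub n : S n `<=` `]a, b[%classic.
  move=> x; rewrite /S/= !in_itv/= => /andP[ax xb]; apply/andP; split.
    by apply: lt_le_trans ax; rewrite ltrDl.
  by apply: le_lt_trans xb _; rewrite gtrBl.
have S_cup : \bigcup_n S n = `]a, b[%classic.
  apply/seteqP; split=> [x [n _]|x /=]; first exact: S_sub.
  rewrite in_itv/= => /andP[ax xb].
  have /filter_ex[n /andP[en1 en2]] :
      \forall n \near \oo, (e n <= x - a) && (e n <= b - x).
    near=> n; apply/andP; split; near: n.
      apply: cvgr_le e_cvg _ _; lra.
    apply: cvgr_le e_cvg _ _; lra.
  by exists n => //; rewrite /S/= in_itv/=; apply/andP; split; lra.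
have mf : measurable_fun `]a, b[ f.
  by apply: open_continuous_measurable_fun => // x; rewrite inE => /cf.
rewrite integral_itv_bndoo; last exact/measurable_EFinP.
rewrite -S_cup.
have : (\int[mu]_(x in S n) (f x)%:E @[n --> \oo] -->
        \int[mu]_(x in \bigcup_n S n) (f x)%:E)%E.
  apply: ge0_nondecreasing_set_cvg_integral => //.
  - move=> m n mn; apply/subsetPset => x.
    rewrite /S/= !in_itv/= => /andP[h1 h2].
    by have := e_anti _ _ mn; rewrite /= => ?; apply/andP; split; lra.
  - by move=> n; exact: measurable_itv.
  - by move=> n; apply/measurable_EFinP; apply: measurable_funS mf.
  - by move=> n x /S_sub xab; rewrite lee_fin f0.
move/cvg_unique; apply => //.
have -> : (fun n => \int[mu]_(x in S n) (f x)%:E)%E =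
          (fun n => (F (b - e n) - F (a + e n))%:E).
  apply/funext => n; rewrite EFinB /S.
  apply: continuous_FTC2 => //.
  - apply: continuous_in_subspaceT => x; rewrite inE => /S_sub; exact: cf.
  - have dFn : {within `[a + e n, b - e n], continuous F}.
      apply: derivable_within_continuous => x /S_sub xab.
      by have := dF _ xab => -[].
    move/(continuous_within_itvP _ (e_mid n)) : dFn => [_ h1 h2]; split => //.
    move=> x xab; have /dF[]// : x \in `]a, b[.
    by apply: (S_sub n) => /=; exact: subset_itv_oo_cc.
  - move=> x xab; rewrite derive1E; have /dF[]// : x \in `]a, b[.
    by apply: (S_sub n) => /=; exact: subset_itv_oo_cc.
apply: cvg_EFin; first exact: nearW.
apply: cvgB.
- have /cvg_at_leftP := Fr; apply; split.
    by move=> n; rewrite gtrBl.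
  by rewrite -[X in _ --> X]subr0; apply: cvgB => //; exact: cvg_cst.
- have /cvg_at_rightP := Fl; apply; split.
    by move=> n; rewrite ltrDl.
  by rewrite -[X in _ --> X]addr0; apply: cvgD => //; exact: cvg_cst.
Unshelve. all: by end_near. Qed.

End ImproperFTC.

(** * The Beta integral *)

Lemma integrable_mulrl d (T : measurableType d) (R : realType)
    (mu : {measure set T -> \bar R}) (D : set T) (k : R) (f : T -> R) :
  measurable D -> mu.-integrable D (EFin \o f) ->
  mu.-integrable D (EFin \o (fun u => k * f u)).
Proof. by move=> mD fi; exact: (integrableZl mD k fi). Qed.

Section BetaIntegral.
Context {R : realType}.
Local Notation mu := (@lebesgue_measure R).
Implicit Types a b u : R.

Definition beta_weight a b u : R := u `^ (a - 1) * (1 - u) `^ (b - 1).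

Lemma beta_weight_ge0 a b u : 0 <= beta_weight a b u.
Proof. by rewrite mulr_ge0 ?powR_ge0. Qed.

Lemma powR_base1 a : (1 : R) `^ a = 1. Proof. by rewrite powR1. Qed.

Lemma measurable_onem_powR a (D : set R) :
  measurable_fun D (fun u => (1 - u) `^ a).
Proof.
apply: measurable_funTS; apply: (measurableT_comp (measurable_powR a)).
exact: measurable_funB.
Qed.

Lemma measurable_beta_weight a b (D : set R) :
  measurable_fun D (beta_weight a b).
Proof.
apply: measurable_funM; last exact: measurable_onem_powR.
by apply: measurable_funTS; exact: measurable_powR.
Qed.

Lemma is_derive_onem_powR a u : u < 1 ->
  is_derive u (1 : R) (fun v => (1 - v) `^ a) (- (a * (1 - u) `^ (a - 1))).
Proof.
move=> u1; have u0 : 0 < 1 - u by rewrite subr_gt0.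
have h := is_derive1_powR a u0.
have h2 : is_derive u (1 : R) (fun v : R => 1 - v) (- 1).
  have := is_deriveB (is_derive_cst (1 : R) u 1) (is_derive_id u 1).
  by rewrite sub0r.
have := @is_derive1_comp _ (fun v : R => v `^ a) (fun v => 1 - v) u _ _ h h2.
by rewrite /= mulrN1.
Qed.

Lemma continuous_powR_gt0 a u : 0 < u -> {for u, continuous (fun v => v `^ a)}.
Proof.
move=> u0; apply/differentiable_continuous/derivable1_diffP.
by case: (is_derive1_powR a u0).
Qed.

Lemma continuous_onem_powR a u : u < 1 ->
  {for u, continuous (fun v : R => (1 - v) `^ a)}.
Proof.
move=> u1; apply/differentiable_continuous/derivable1_diffP.
by case: (is_derive_onem_powR a u1).
Qed.

Lemma onem_powR_cvg0 a : 0 < a -> (1 - u) `^ a @[u --> (1 : R)^'-] --> (0 : R).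
Proof.
move=> a0; apply/cvg_at_leftP => v [v1 vl].
have /cvg_at_rightP/(_ (fun n => 1 - v n)) := powR_cvg0 a0; apply; split.
  by move=> n; rewrite subr_gt0.
by rewrite -[X in _ --> X](subrr 1); apply: cvgB => //; exact: cvg_cst.
Qed.

Lemma integral_powR a : 0 < a ->
  (\int[mu]_(u in `[0%R, 1%R]) (a * u `^ (a - 1))%:E = 1)%E.
Proof.
move=> a0; rewrite (@ge0_improper_FTC2 _ _ (fun u => u `^ a) 0 1 0 1) ?subr0//.
- by move=> u _; rewrite mulr_ge0 ?powR_ge0// ltW.
- move=> u; rewrite in_itv/= => /andP[u0 _].
  by apply: cvgM; [exact: cvg_cst|exact: continuous_powR_gt0].
- by move=> u; rewrite in_itv/= => /andP[u0 _]; exact: is_derive1_powR.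
- exact: powR_cvg0.
- rewrite -[X in _ --> X](powR_base1 a); apply: cvg_at_left_filter.
  exact: continuous_powR_gt0.
Qed.

Lemma integral_onem_powR a : 0 < a ->
  (\int[mu]_(u in `[0%R, 1%R]) (a * (1 - u) `^ (a - 1))%:E = 1)%E.
Proof.
move=> a0; rewrite (@ge0_improper_FTC2 _ _ (fun u => - (1 - u) `^ a)
  0 1 (- 1) 0) ?opprK ?add0r//.
- by move=> u _; rewrite mulr_ge0 ?powR_ge0// ltW.
- move=> u; rewrite in_itv/= => /andP[_ u1].
  by apply: cvgM; [exact: cvg_cst|exact: continuous_onem_powR].
- move=> u; rewrite in_itv/= => /andP[_ u1].
  have := is_deriveN (is_derive_onem_powR a u1); rewrite opprK; exact.
- apply: cvgN; rewrite -[X in _ --> X](powR_base1 a) -[X in powR X a](subr0 1).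
  by apply: cvg_at_right_filter; exact: continuous_onem_powR.
- rewrite -oppr0; apply: cvgN; exact: onem_powR_cvg0.
Qed.

Lemma ge0_integrable (D : set R) (f : R -> R) (m : R) : measurable D ->
  measurable_fun D f -> (forall u, D u -> 0 <= f u) ->
  (\int[mu]_(u in D) (f u)%:E = m%:E)%E -> mu.-integrable D (EFin \o f).
Proof.
move=> mD mf f0 fm; apply/integrableP; split; first exact/measurable_EFinP.
rewrite [ltLHS](_ : _ = m%:E) ?ltry// -fm; apply: eq_integral => u.
by rewrite inE => uD; rewrite /= ger0_norm// f0.
Qed.

Lemma integrable_powR a : 0 < a ->
  mu.-integrable `[0, 1] (EFin \o (fun u => u `^ (a - 1))).
Proof.
move=> a0.
have : mu.-integrable `[0, 1] (EFin \o (fun u => a * u `^ (a - 1))).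
  apply: (@ge0_integrable _ _ 1) => //; last exact: integral_powR.
    apply: measurable_funM => //; apply: measurable_funTS.
    exact: measurable_powR.
  by move=> u _; rewrite mulr_ge0 ?powR_ge0// ltW.
move=> h; have : mu.-integrable `[0, 1]
    (EFin \o (fun u => a^-1 * (a * u `^ (a - 1)))).
  by apply: integrable_mulrl.
by apply: eq_integrable => // u _ /=; rewrite mulKf ?gt_eqF.
Qed.

Lemma integrable_onem_powR a : 0 < a ->
  mu.-integrable `[0, 1] (EFin \o (fun u => (1 - u) `^ (a - 1))).
Proof.
move=> a0.
have : mu.-integrable `[0, 1] (EFin \o (fun u => a * (1 - u) `^ (a - 1))).
  apply: (@ge0_integrable _ _ 1) => //; last exact: integral_onem_powR.
    by apply: measurable_funM => //; exact: measurable_onem_powR.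
  by move=> u _; rewrite mulr_ge0 ?powR_ge0// ltW.
move=> h; have : mu.-integrable `[0, 1]
    (EFin \o (fun u => a^-1 * (a * (1 - u) `^ (a - 1)))).
  by apply: integrable_mulrl.
by apply: eq_integrable => // u _ /=; rewrite mulKf ?gt_eqF.
Qed.

Lemma powR_le1 a u : 0 <= a -> 0 <= u <= 1 -> u `^ a <= 1.
Proof.
move=> a0 /andP[u0 u1]; rewrite -(powR_base1 a).
by apply: ge0_ler_powR => //; rewrite nnegrE.
Qed.

(** This is [1 = u + (1 - u)] times the weight. *)
Lemma beta_weightD a b u : 0 < a -> 0 < b -> 0 <= u <= 1 ->
  beta_weight a b u = beta_weight (a + 1) b u + beta_weight a (b + 1) u.
Proof.
move=> a0 b0 /andP[u0 u1]; rewrite /beta_weight !addrK.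
rewrite -(mulr_powRB1 u0 a0) -(@mulr_powRB1 _ (1 - u) b) ?subr_ge0//.
by ring.
Qed.

(** Raising either parameter by one makes the corresponding factor at most 1,
    which leaves a single integrable power; [beta_weightD] then comes back to
    the given parameters. *)
Lemma integrable_beta_weight a b : 0 < a -> 0 < b ->
  mu.-integrable `[0, 1] (EFin \o beta_weight a b).
Proof.
move=> a0 b0.
have i1 : mu.-integrable `[0, 1] (EFin \o beta_weight (a + 1) b).
  apply: le_integrable (integrable_onem_powR b0) => //.
    by apply/measurable_EFinP; exact: measurable_beta_weight.
  move=> u /=; rewrite in_itv/= => u01.
  rewrite lee_fin !ger0_norm ?beta_weight_ge0 ?powR_ge0//.
  rewrite /beta_weight addrK ler_piMl ?powR_ge0//; apply: powR_le1 => //.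
  exact: ltW.
have i2 : mu.-integrable `[0, 1] (EFin \o beta_weight a (b + 1)).
  apply: le_integrable (integrable_powR a0) => //.
    by apply/measurable_EFinP; exact: measurable_beta_weight.
  move=> u /=; rewrite in_itv/= => /andP[u0 u1].
  rewrite lee_fin !ger0_norm ?beta_weight_ge0 ?powR_ge0//.
  rewrite /beta_weight addrK ler_piMr ?powR_ge0//; apply: powR_le1.
    exact: ltW.
  by apply/andP; split; lra.
have : mu.-integrable `[0, 1]
    ((EFin \o beta_weight (a + 1) b) \+ (EFin \o beta_weight a (b + 1)))%E.
  by apply: integrableD.
apply: eq_integrable => // u.
by rewrite inE/= in_itv/= => u01; rewrite -EFinD -beta_weightD.
Qed.

Lemma BetaD a b : 0 < a -> 0 < b -> Beta a b = Beta (a + 1) b + Beta a (b + 1).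
Proof.
move=> a0 b0; rewrite -RintegralD//; last 2 first.
- by apply: integrable_beta_weight; lra.
- by apply: integrable_beta_weight; lra.
apply: eq_Rintegral => u; rewrite inE/= in_itv/= => u01.
exact: beta_weightD.
Qed.

(** Integrate the derivative [f] of [u `^ a * (1 - u) `^ b], which vanishes at 0
    and 1.  Since [f] changes sign, [b * (1 - u) `^ (b - 1)] is added to it: the
    sum is nonnegative because [u `^ a <= 1], and both the sum and the added
    function have integral 1. *)
Lemma Beta_balance a b : 0 < a -> 0 < b ->
  a * Beta a (b + 1) = b * Beta (a + 1) b.
Proof.
move=> a0 b0.
pose f u := a * u `^ (a - 1) * (1 - u) `^ b - u `^ a * (b * (1 - u) `^ (b - 1)).
pose g u := f u + b * (1 - u) `^ (b - 1).
have intg : (\int[mu]_(u in `[0%R, 1%R]) (g u)%:E = 1)%E.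
  rewrite (@ge0_improper_FTC2 _ _
    (fun u => u `^ a * (1 - u) `^ b - (1 - u) `^ b)
    0 1 (- 1) 0) ?opprK ?add0r//.
  - move=> u; rewrite in_itv/= => /andP[u0 u1].
    rewrite /g /f -addrA; apply: addr_ge0.
      by rewrite !mulr_ge0 ?powR_ge0// ltW.
    rewrite addrC subr_ge0; apply: ler_piMl.
      by rewrite mulr_ge0 ?powR_ge0// ltW.
    by apply: powR_le1; [exact: ltW|rewrite !ltW].
  - move=> u; rewrite in_itv/= => /andP[u0 u1].
    have c1 p := @continuous_powR_gt0 p _ u0.
    have c2 p := @continuous_onem_powR p _ u1.
    have cc p : {for u, continuous (fun _ : R => p : R)} by exact: cvg_cst.
    apply: cvgD; last exact: cvgM (cc b) (c2 _).
    by apply: cvgB; [exact: cvgM (cvgM (cc a) (c1 _)) (c2 _)|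
                     exact: cvgM (c1 _) (cvgM (cc b) (c2 _))].
  - move=> u; rewrite in_itv/= => /andP[u0 u1].
    have d1 := @is_derive1_powR _ a _ u0.
    have d2 := @is_derive_onem_powR b _ u1.
    have := is_deriveB (is_deriveM d1 d2) d2.
    move/is_derive_eq; apply; rewrite /g /f /= opprK /GRing.scale /=; ring.
  - have c0 : (1 - u) `^ b @[u --> (0 : R)^'+] --> (1 - 0 : R) `^ b.
      by apply: cvg_at_right_filter; exact: continuous_onem_powR.
    have := cvgB (cvgM (powR_cvg0 a0) c0) c0.
    by rewrite mul0r sub0r subr0 powR_base1; apply.
  - have c1 : u `^ a @[u --> (1 : R)^'-] --> (1 : R) `^ a.
      by apply: cvg_at_left_filter; exact: continuous_powR_gt0.
    have := cvgB (cvgM c1 (onem_powR_cvg0 b0)) (onem_powR_cvg0 b0).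
    by rewrite mulr0 subr0; apply.
have i1 : mu.-integrable `[0, 1]
    (EFin \o (fun u => a * beta_weight a (b + 1) u)).
  by apply: integrable_mulrl => //; apply: integrable_beta_weight; lra.
have i2 : mu.-integrable `[0, 1]
    (EFin \o (fun u => b * beta_weight (a + 1) b u)).
  by apply: integrable_mulrl => //; apply: integrable_beta_weight; lra.
have i3 : mu.-integrable `[0, 1] (EFin \o (fun u => b * (1 - u) `^ (b - 1))).
  by apply: integrable_mulrl => //; exact: integrable_onem_powR.
have i12 : mu.-integrable `[0, 1] (EFin \o (fun u =>
    a * beta_weight a (b + 1) u - b * beta_weight (a + 1) b u)).
  by have := integrableB _ i1 i2; apply.
have : \int[mu]_(u in `[0, 1]) g u = 1 by rewrite /Rintegral intg.
have -> : \int[mu]_(u in `[0, 1]) g u =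
  \int[mu]_(u in `[0, 1]) (a * beta_weight a (b + 1) u
    - b * beta_weight (a + 1) b u + b * (1 - u) `^ (b - 1)).
  by apply: eq_Rintegral => u _; rewrite /g /f /beta_weight !addrK; ring.
have j1 : mu.-integrable `[0, 1] (EFin \o beta_weight a (b + 1)).
  by apply: integrable_beta_weight; lra.
have j2 : mu.-integrable `[0, 1] (EFin \o beta_weight (a + 1) b).
  by apply: integrable_beta_weight; lra.
have m01 : measurable (`[0, 1]%classic : set (measurableTypeR R)).
  exact: measurable_itv.
have -> := RintegralD m01 i12 i3.
have -> := RintegralB m01 i1 i2.
have -> := RintegralZl a m01 j1.
have -> := RintegralZl b m01 j2.
have -> : \int[mu]_(u in `[0, 1]) (b * (1 - u) `^ (b - 1)) = 1.
  by rewrite /Rintegral (integral_onem_powR b0).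
rewrite -/(Beta a (b + 1)) -/(Beta (a + 1) b) => h; lra.
Qed.

(** [BetaD] and [Beta_balance] are two linear equations for [Beta (a + 1) b] and
    [Beta a (b + 1)]. *)
Lemma BetaS a b : 0 < a -> 0 < b -> Beta (a + 1) b = a / (a + b) * Beta a b.
Proof.
move=> a0 b0; have h := BetaD a0 b0; have h2 := Beta_balance a0 b0.
have ab : a + b != 0 by rewrite gt_eqF// addr_gt0.
rewrite h; have -> : Beta a (b + 1) = b * Beta (a + 1) b / a.
  by rewrite -h2; field; rewrite gt_eqF.
by field; rewrite ab gt_eqF.
Qed.

(** For a natural number [m >= a, b] the weight dominates [u ^ m * (1 - u) ^ m],
    whose integral is known to be positive. *)
Lemma Beta_gt0 a b : 0 < a -> 0 < b -> 0 < Beta a b.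
Proof.
move=> a0 b0.
have [m am bm] : exists2 m : nat, a <= m%:R & b <= m%:R.
  exists (maxn (Num.truncn a).+1 (Num.truncn b).+1).
    by apply: le_trans (ltW (truncnS_gt a)) _; rewrite ler_nat leq_maxl.
  by apply: le_trans (ltW (truncnS_gt b)) _; rewrite ler_nat leq_maxr.
have m0 : (0 < m)%N by rewrite -(ltr_nat R); exact: lt_le_trans am.
have bf := @beta_fun_gt0 R m.+1 m.+1; apply: (lt_le_trans bf).
rewrite /beta_fun -Rintegral_mkcond /=; apply: le_Rintegral => //.
- exact: integrable_XMonemX.
- exact: integrable_beta_weight.
move=> u /=; rewrite in_itv/= => /andP[u0 u1]; rewrite /XMonemX /unstable.onem.
move: u0; rewrite le_eqVlt => /predU1P[<-|u0].
  by rewrite expr0n gtn_eqF//= mul0r mulr_ge0 ?powR_ge0.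
move: u1; rewrite le_eqVlt => /predU1P[->|u1].
  by rewrite subrr expr0n gtn_eqF//= mulr0 mulr_ge0 ?powR_ge0.
rewrite -!powR_mulrn ?subr_ge0 ?(ltW u0) ?(ltW u1)//.
apply: ler_pM; rewrite ?powR_ge0//; apply: ger_powR; first by rewrite u0 ltW.
- lra.
- by rewrite subr_gt0 u1; lra.
- lra.
Qed.

End BetaIntegral.

(** * Affine change of variables *)

Section AffineChange.
Context {R : realType}.
Local Notation mu := (@lebesgue_measure R).
Local Open Scope ereal_scope.

Let affine (c k : R) : measurableTypeR R -> measurableTypeR R :=
  fun u => (c + k * u)%R.

Let measurable_affine c k : measurable_fun setT (affine c k).
Proof.
apply: continuous_measurable_fun => u.
by apply: cvgD; [exact: cvg_cst|apply: cvgM; [exact: cvg_cst|exact: cvg_id]].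
Qed.

Let lebesgue_measure_affine c (k : R) (k0 : (0 < k)%R) A : measurable A ->
  mu A = pushforward (mscale (NngNum (ltW k0)) mu) (affine c k) A.
Proof.
move=> mA.
apply: (@lebesgue_measure_unique _
    (pushforward (mscale (NngNum (ltW k0)) mu) (affine c k))) => //.
move=> _ [[a b] _ <-].
rewrite /pushforward /= /mscale /=.
rewrite [X in _ = _ * lebesgue_measure X](_ : _ =
    `]((a - c) / k)%R, ((b - c) / k)%R]%classic); last first.
  apply/seteqP; split=> u; rewrite /affine /= !in_itv/=.
    rewrite ltr_pdivrMr// ler_pdivlMr// => /andP[? ?].
    by apply/andP; split; lra.
  rewrite ltr_pdivrMr// ler_pdivlMr// => /andP[? ?].
  by apply/andP; split; lra.
rewrite !lebesgue_measure_itv/= !lte_fin ltr_pM2r ?invr_gt0// ltrD2r.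
case: ifP => _; last by rewrite mule0.
by rewrite -!EFinB -EFinM; congr EFin; field; rewrite gt_eqF.
Qed.

(** Lebesgue measure is [k] times its pushforward under [u |-> c + k * u], since
    both measures agree on half-open intervals.  No continuity is required, so
    the formula covers integrands that are unbounded near an end point. *)
Lemma ge0_integral_affine c (k : R) (D : set (measurableTypeR R))
    (f : measurableTypeR R -> \bar R) : (0 < k)%R ->
    measurable D -> measurable_fun setT f -> (forall x, 0 <= f x) ->
  \int[mu]_(x in D) f x =
  k%:E * \int[mu]_(u in (fun u => c + k * u)%R @^-1` D) f (c + k * u)%R.
Proof.
move=> k0 mD mf f0.
transitivity
  (\int[pushforward (mscale (NngNum (ltW k0)) mu) (affine c k)]_(x in D) f x).
  apply: eq_measure_integral => A mA _.
  exact: lebesgue_measure_affine.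
rewrite ge0_integral_pushforward//; last exact: measurable_funTS.
rewrite ge0_integral_mscale//=.
- by rewrite -[X in measurable X]setTI; exact: measurable_affine.
- by apply: measurable_funTS; apply: measurableT_comp.
Qed.

Lemma Rintegral_affine c (k : R) (D : set (measurableTypeR R))
    (f : measurableTypeR R -> R) : (0 < k)%R ->
    measurable D -> measurable_fun setT f ->
    mu.-integrable ((fun u => c + k * u)%R @^-1` D)
      (EFin \o (fun u => f (c + k * u)%R)) ->
  (\int[mu]_(x in D) f x =
  k * \int[mu]_(u in (fun u => c + k * u)%R @^-1` D) f (c + k * u))%R.
Proof.
move=> k0 mD mf fi; rewrite /Rintegral.
have mDphi : measurable
    ((fun u => c + k * u)%R @^-1` D : set (measurableTypeR R)).
  by rewrite -[X in measurable X]setTI; exact: measurable_affine.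
have mEf : measurable_fun setT (EFin \o f) by exact/measurable_EFinP.
suff -> : \int[mu]_(x in D) (f x)%:E =
  k%:E * \int[mu]_(u in (fun u => c + k * u)%R @^-1` D) (f (c + k * u)%R)%:E.
  by rewrite fineM//; exact: integrable_fin_num.
transitivity (k%:E * \int[mu]_(u in (fun u => c + k * u)%R @^-1` D)
                (EFin \o (fun u => f (c + k * u)%R))^\+ u
            - k%:E * \int[mu]_(u in (fun u => c + k * u)%R @^-1` D)
                (EFin \o (fun u => f (c + k * u)%R))^\- u).
  rewrite integralE.
  have -> := @ge0_integral_affine c k D (EFin \o f)^\+ k0 mD
    (measurable_funepos mEf) (funepos_ge0 _).
  have -> := @ge0_integral_affine c k D (EFin \o f)^\- k0 mD
    (measurable_funeneg mEf) (funeneg_ge0 _).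
  congr (_ * _ - _ * _); apply: eq_integral => u _.
    by rewrite !funeposE.
  by rewrite !funenegE.
rewrite -muleBr//; last first.
  have fneg := integrable_neg_fin_num mDphi fi.
  by apply: fin_num_adde_defl; rewrite fin_numN.
by congr (_ * _); rewrite [RHS]integralE.
Qed.

End AffineChange.

(** * Expectations under the Beta distribution *)

Section BetaMean.
Context {R : realType}.
Local Notation mu := (@lebesgue_measure R).
Implicit Types a b c u x : R.
Implicit Types f g : R -> R.

Definition beta_mean a b g : R :=
  (Beta a b)^-1 * \int[mu]_(u in `[0, 1]) (g u * beta_weight a b u).

Let m01 : measurable (`[0, 1]%classic : set (measurableTypeR R)).
Proof. exact: measurable_itv. Qed.

Lemma eq_beta_mean a b f g : {in `[0, 1], f =1 g} ->
  beta_mean a b f = beta_mean a b g.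
Proof.
move=> fg; congr (_ * _); apply: eq_Rintegral => u.
by rewrite inE/= => /fg ->.
Qed.

Lemma continuous_affine_exp c k n u :
  {for u, continuous (fun v : R => (c + k * v) ^+ n)}.
Proof.
elim: n => [|n IHn]; first exact: cvg_cst.
have -> : (fun v : R => (c + k * v) ^+ n.+1) =
    (fun v => (c + k * v) * (c + k * v) ^+ n).
  by apply/funext => v; rewrite exprS.
apply: cvgM => //; apply: cvgD; first exact: cvg_cst.
by apply: cvgM; [exact: cvg_cst|exact: cvg_id].
Qed.

Lemma continuous_sum_in (A : {pred R}) (F : nat -> R -> R) n :
    (forall i, {in A, continuous (F i)}) ->
  {in A, continuous (fun u => \sum_(i < n) F i u)}.
Proof.
move=> cF u uA; have -> : (fun v => \sum_(i < n) F i v) = \sum_(i < n) F i.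
  by apply/funext => v; rewrite fct_sumE.
apply: (big_ind (fun f => {for u, continuous f})).
- exact: cvg_cst.
- by move=> f g cf cg; exact: cvgD.
- by move=> i _; exact: cF.
Qed.

Lemma continuous_resolvent x c u : 1 - x * (c + 4 * u) != 0 ->
  {for u, continuous (fun v : R => (1 - x * (c + 4 * v))^-1)}.
Proof.
move=> h; apply: cvgV => //; apply: cvgB; first exact: cvg_cst.
by apply: cvgMl_tmp; exact: (@continuous_affine_exp c 4 1).
Qed.

Section Shape.
Variables (a b : R) (a0 : 0 < a) (b0 : 0 < b).

(** Continuity is asked at every point of [[0, 1]] rather than within [[0, 1]]:
    this is stable under the pointwise operations used below. *)
Lemma integrable_mul_beta_weight g : {in `[0, 1], continuous g} ->
  mu.-integrable `[0, 1] (EFin \o (fun u => g u * beta_weight a b u)).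
Proof.
move=> cg.
have cg01 : {within `[0, 1], continuous g}.
  by apply: continuous_in_subspaceT => u; rewrite inE; exact: cg.
have : mu.-integrable `[0, 1] ((EFin \o g) \* (EFin \o beta_weight a b))%E.
  apply: integrableMr => //.
  - exact: subspace_continuous_measurable_fun.
  - have := continuous_compact cg01 (@segment_compact _ 0 1).
    move=> /compact_bounded[M [Mr gM]]; exists M; split => // N MN u u01.
    by apply: (gM N MN); exists u.
  - exact: integrable_beta_weight.
by apply: eq_integrable.
Qed.

Lemma beta_meanD f g :
    {in `[0, 1], continuous f} -> {in `[0, 1], continuous g} ->
  beta_mean a b (fun u => f u + g u) = beta_mean a b f + beta_mean a b g.
Proof.
move=> /integrable_mul_beta_weight fi /integrable_mul_beta_weight gi.
rewrite /beta_mean -mulrDr; congr (_ * _); rewrite -(RintegralD m01 fi gi).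
by apply: eq_Rintegral => u _; rewrite mulrDl.
Qed.

Lemma beta_meanZ k g : {in `[0, 1], continuous g} ->
  beta_mean a b (fun u => k * g u) = k * beta_mean a b g.
Proof.
move=> /integrable_mul_beta_weight gi.
rewrite /beta_mean mulrCA; congr (_ * _); rewrite -(RintegralZl k m01 gi).
by apply: eq_Rintegral => u _; rewrite mulrA.
Qed.

Lemma beta_mean_sum (F : nat -> R -> R) n :
    (forall i, {in `[0, 1], continuous (F i)}) ->
  beta_mean a b (fun u => \sum_(i < n) F i u) =
  \sum_(i < n) beta_mean a b (F i).
Proof.
move=> cF; elim: n => [|n IHn].
  have c1 : {in `[0, 1], continuous (fun _ : R => 1 : R)}.
    by move=> u _; exact: cvg_cst.
  rewrite big_ord0 -[RHS](mul0r (beta_mean a b (fun=> 1))) -(beta_meanZ 0 c1).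
  by apply: eq_beta_mean => u _; rewrite big_ord0 mul0r.
rewrite big_ord_recr /= -IHn -beta_meanD//.
  by apply: eq_beta_mean => u _; rewrite big_ord_recr.
exact: continuous_sum_in.
Qed.

Lemma beta_mean_le M g : {in `[0, 1], continuous g} ->
  {in `[0, 1], forall u, `|g u| <= M} -> `|beta_mean a b g| <= M.
Proof.
move=> cg gM; have B0 := Beta_gt0 a0 b0.
rewrite /beta_mean normrM normfV (gtr0_norm B0) mulrC ler_pdivrMr//.
have wi : mu.-integrable `[0, 1] (EFin \o beta_weight a b).
  exact: integrable_beta_weight.
have gi := integrable_mul_beta_weight cg.
apply: le_trans (le_normr_Rintegral m01 gi) _.
rewrite -(RintegralZl M m01 wi); apply: le_Rintegral => //.
- exact: integrable_norm.
- exact: integrable_mulrl.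
move=> u /= u01; rewrite normrM (ger0_norm (beta_weight_ge0 _ _ _)).
by rewrite ler_wpM2r ?beta_weight_ge0 ?gM.
Qed.

Lemma beta_mean_exp0 : beta_mean a b (fun u => u ^+ 0) = 1.
Proof.
have -> : beta_mean a b (fun u => u ^+ 0) = (Beta a b)^-1 * Beta a b.
  by congr (_ * _); apply: eq_Rintegral => u _; rewrite expr0 mul1r.
by rewrite mulVf// gt_eqF// Beta_gt0.
Qed.

Lemma beta_mean_expE n :
  beta_mean a b (fun u => u ^+ n) = (Beta a b)^-1 * Beta (a + n%:R) b.
Proof.
congr (_ * _); apply: eq_Rintegral => u; rewrite inE/= in_itv/= => /andP[u01 _].
elim: n => [|n IHn]; first by rewrite expr0 mul1r addr0.
rewrite exprS -mulrA IHn /beta_weight mulrA mulr_powRB1//.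
  by rewrite -natr1 addrA addrK.
by rewrite ltr_wpDr.
Qed.

Lemma beta_mean_expS n : beta_mean a b (fun u => u ^+ n.+1) =
  (a + n%:R) / (a + b + n%:R) * beta_mean a b (fun u => u ^+ n).
Proof.
rewrite !beta_mean_expE -natr1 addrA BetaS ?ltr_wpDr//.
by rewrite mulrCA (addrAC a b).
Qed.

(** The powers of 4 produced by the two factors of the weight and by the
    Jacobian cancel the constant [4 `^ (a + b - 1)]. *)
Lemma momentE c n :
  moment c a b n = beta_mean a b (fun u => (c + 4 * u) ^+ n).
Proof.
pose f x := x ^+ n * ((x - c) `^ (a - 1) * (4 + c - x) `^ (b - 1) /
               (4 `^ (a + b - 1) * Beta a b)).
have pre : (fun u : R => c + 4 * u) @^-1` `[c, 4 + c] = `[0, 1]%classic.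
  apply/seteqP; split=> u; rewrite /= !in_itv/= => /andP[? ?];
  by apply/andP; split; lra.
have B0 := Beta_gt0 a0 b0.
have f4 u : u \in `[0, 1] -> f (c + 4 * u) =
    (4 * Beta a b)^-1 * ((c + 4 * u) ^+ n * beta_weight a b u).
  rewrite in_itv/= => /andP[u0 u1]; rewrite /f /beta_weight.
  have -> : c + 4 * u - c = 4 * u by ring.
  have -> : 4 + c - (c + 4 * u) = 4 * (1 - u) by ring.
  rewrite !powRM// ?subr_ge0//.
  have -> : (4 : R) `^ (a + b - 1) = 4 * (4 `^ (a - 1) * 4 `^ (b - 1)).
    rewrite -powRD ?pnatr_eq0 ?implybT// -{2}[4](@powRr1 _ 4)//.
    rewrite -powRD ?pnatr_eq0 ?implybT//.
    by congr (_ `^ _); ring.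
  by field; rewrite !gt_eqF ?powR_gt0.
have ci : {in `[0, 1], continuous (fun u : R => (c + 4 * u) ^+ n)}.
  by move=> u _; exact: continuous_affine_exp.
have fi : mu.-integrable `[0, 1] (EFin \o (fun u => f (c + 4 * u))).
  have := integrable_mulrl (4 * Beta a b)^-1 m01
    (integrable_mul_beta_weight ci).
  by apply: eq_integrable => // u; rewrite inE/= => /f4 /= ->.
have mf : measurable_fun setT (f : measurableTypeR R -> R).
  apply: measurable_funM; first exact: measurable_funX.
  apply: measurable_funM => //; apply: measurable_funM.
    apply: (measurableT_comp (measurable_powR (a - 1))).
    exact: measurable_funB.
  apply: (measurableT_comp (measurable_powR (b - 1))).
  exact: measurable_funB.
have k0 : 0 < 4 :> R by [].
have m04 : measurable (`[c, 4 + c]%classic : set (measurableTypeR R)).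
  exact: measurable_itv.
have := @Rintegral_affine _ c 4 _ f k0 m04 mf; rewrite pre => /(_ fi).
rewrite /moment -/f => ->; rewrite /beta_mean.
transitivity (4 * \int[mu]_(u in `[0, 1])
    ((4 * Beta a b)^-1 * ((c + 4 * u) ^+ n * beta_weight a b u))).
  by congr (_ * _); apply: eq_Rintegral => u; rewrite inE/= => /f4.
rewrite (RintegralZl _ m01 (integrable_mul_beta_weight ci)) mulrA.
by congr (_ * _); field; rewrite gt_eqF.
Qed.

End Shape.
End BetaMean.

(** * Power series near 0 *)

Section GeneratingFunctions.
Context {R : realType}.
Implicit Types (a b : R^nat) (F G : R -> R).

(** The bound [1 / 2] on the ratio lets the geometric sum telescope:
    [z ^ n <= 2 * (z ^ n - z ^ n.+1)]. *)
Lemma geometric_tail (v : R^nat) (M z : R) m p : 0 <= z <= 2^-1 ->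
    (forall n, `|v n| <= M * z ^+ n) ->
  `|\sum_(m <= n < p) v n| <= 2 * M * z ^+ m.
Proof.
move=> /andP[z0 z2] vM.
have M0 : 0 <= M by have := vM 0%N; rewrite expr0 mulr1; exact: le_trans.
have [pm|/ltnW mp] := leqP p m.
  by rewrite big_geq// normr0 !mulr_ge0// exprn_ge0.
suff : `|\sum_(m <= n < p) v n| <= 2 * M * (z ^+ m - z ^+ p).
  move/le_trans; apply; rewrite ler_wpM2l ?mulr_ge0//.
  by rewrite gerBl exprn_ge0.
rewrite -(subnKC mp); elim: (p - m)%N => [|k IHk].
  by rewrite addn0 big_geq// normr0 subrr mulr0.
rewrite addnS big_nat_recr ?leq_addr//=.
apply: le_trans (ler_normD _ _) _; apply: le_trans (lerD IHk (vM _)) _.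
rewrite exprS -subr_ge0.
have -> : 2 * M * (z ^+ m - z * z ^+ (m + k)) -
    (2 * M * (z ^+ m - z ^+ (m + k)) + M * z ^+ (m + k)) =
    M * z ^+ (m + k) * (1 - 2 * z) by ring.
by rewrite !mulr_ge0 ?exprn_ge0//; lra.
Qed.

Lemma has_gf_near a F G : (\forall x \near 0^', F x = G x) ->
  has_gf a F -> has_gf a G.
Proof.
move=> FG aF; rewrite /has_gf; near=> x.
have <- : F x = G x by near: x.
by near: x.
Unshelve. all: by end_near. Qed.

Lemma eq_has_gf a b F : a =1 b -> has_gf a F -> has_gf b F.
Proof. by move=> /funext ->. Qed.

Lemma has_gf_fun_unique a F G : has_gf a F -> has_gf a G ->
  \forall x \near 0^', F x = G x.
Proof.
move=> aF aG; near=> x.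
have h1 : pseries a x @ \oo --> F x by near: x.
have h2 : pseries a x @ \oo --> G x by near: x.
exact: (cvg_unique _ h1 h2).
Unshelve. all: by end_near. Qed.

(** Convergence at a single nonzero point bounds the terms of the series there,
    hence gives absolute convergence with geometric tails near 0. *)
Lemma has_gf_growth a F : has_gf a F ->
  exists2 K, 0 <= K & exists2 r, 0 < r & forall n, `|a n| <= K * r ^+ n.
Proof.
move=> aF.
have [x [ax x0]] : exists x, pseries a x @ \oo --> F x /\ x != 0.
  apply: (@filter_ex _ (0 : R)^'); near=> x; split; near: x; first exact: aF.
  exact: (@nbhs_dnbhs_neq R 0).
have /cvg_series_cvg_0 a0 : cvgn (pseries a x) by apply/cvg_ex; exists (F x).
have /cvg_seq_bounded[M [_ aM]] : cvgn (fun n => a n * x ^+ n).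
  by apply/cvg_ex; exists 0.
exists (`|M| + 1) => //; exists `|x|^-1; first by rewrite invr_gt0 normr_gt0.
move=> n; rewrite exprVn ler_pdivlMr ?exprn_gt0 ?normr_gt0// -normrX -normrM.
by apply: aM => //; rewrite (le_lt_trans (ler_norm _))// ltrDl.
Unshelve. all: by end_near. Qed.

(** The value of the sum at 0, which [has_gf] leaves out, is forced by
    continuity. *)
Lemma has_gf_at0 a F : has_gf a F -> F x @[x --> 0^'] --> a 0%N.
Proof.
move=> aF; have [K K0 [r r0 aK]] := has_gf_growth aF.
have K1 : 0 < 2 * (K + 1) * r by rewrite !mulr_gt0// ltr_wpDl.
apply/cvgrPdist_le => e e0; near=> x.
have ax : pseries a x @ \oo --> F x by near: x.
have xr : r * `|x| <= 2^-1.
  rewrite mulrC -ler_pdivlMr//; near: x; apply: dnbhs0_le.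
  by rewrite divr_gt0 ?invr_gt0.
have xe : 2 * (K * r * `|x|) <= e.
  apply: (@le_trans _ _ (2 * (K + 1) * r * `|x|)).
    by rewrite !mulrA !ler_wpM2r ?ler_wpM2l ?(ltW r0)// lerDl.
  rewrite mulrC -ler_pdivlMr//; near: x; apply: dnbhs0_le.
  by rewrite divr_gt0 ?invr_gt0.
have axn : `|a 0%N - pseries a x n| @[n --> \oo] --> `|a 0%N - F x|.
  by apply: cvg_norm; apply: cvgB => //; exact: cvg_cst.
apply: (cvgr_to_le axn); near=> n.
have n0 : (0 < n)%N by near: n; exact: nbhs_infty_gt.
apply: le_trans xe.
rewrite /pseries /series/= big_ltn// expr0 mulr1 opprD addrA subrr sub0r normrN.
have -> : 2 * (K * r * `|x|) = 2 * K * (r * `|x|) ^+ 1 by ring.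
apply: (@geometric_tail (fun n => a n * x ^+ n)).
  by rewrite xr mulr_ge0// ltW.
by move=> k; rewrite normrM normrX exprMn mulrA ler_wpM2r ?exprn_ge0.
Unshelve. all: by end_near. Qed.

Lemma has_gfD a b F G : has_gf a F -> has_gf b G ->
  has_gf (fun n => a n + b n) (fun x => F x + G x).
Proof.
move=> aF bG; rewrite /has_gf; near=> x.
have -> : pseries (fun n => a n + b n) x = pseries a x + pseries b x.
  apply/funext => n; rewrite /pseries /series/= fctE -big_split/=.
  by apply: eq_bigr => i _; rewrite mulrDl.
by apply: cvgD; near: x.
Unshelve. all: by end_near. Qed.

Lemma has_gfZ k a F : has_gf a F ->
  has_gf (fun n => k * a n) (fun x => k * F x).
Proof.
move=> aF; rewrite /has_gf; near=> x.
have -> : pseries (fun n => k * a n) x = (fun n => k * pseries a x n).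
  apply/funext => n; rewrite /pseries /series/= mulr_sumr.
  by apply: eq_bigr => i _; rewrite mulrA.
have ax : pseries a x @ \oo --> F x by near: x.
exact: cvgMl_tmp.
Unshelve. all: by end_near. Qed.

Lemma cvg_dnbhs0 F : F x @[x --> 0^'] --> (0 : R) ->
  (\forall x \near 0^', F x != 0) -> F x @[x --> 0^'] --> (0 : R)^'.
Proof.
move=> F0 nF P P0.
have FP : \forall x \near 0^', F x != 0 -> P (F x) by have := F0 _ P0; apply.
change (\forall x \near 0^', P (F x)).
by near=> x; apply: (near FP x) => //; near: x.
Unshelve. all: by end_near. Qed.

Lemma has_gf_scale k a F : k != 0 -> has_gf a F ->
  has_gf (fun n => k ^+ n * a n) (fun x => F (k * x)).
Proof.
move=> k0 aF; rewrite /has_gf.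
have kx : k * x @[x --> (0 : R)^'] --> (0 : R)^'.
  apply: cvg_dnbhs0.
    rewrite -[X in _ --> X](mulr0 k); apply: cvgMl_tmp.
    exact: (@nbhs_dnbhs R 0).
  by near=> x; rewrite mulf_neq0//; near: x; exact: (@nbhs_dnbhs_neq R 0).
near=> x.
have -> : pseries (fun n => k ^+ n * a n) x = pseries a (k * x).
  apply/funext => n; rewrite /pseries /series/=; apply: eq_bigr => i _.
  by rewrite exprMn mulrA (mulrC _ (a i)).
near: x; exact: kx aF.
Unshelve. all: by end_near. Qed.

Lemma has_gf_shift a F : has_gf a F ->
  has_gf (fun n => a n.+1) (fun x => (F x - a 0%N) / x).
Proof.
move=> aF; rewrite /has_gf; near=> x.
have x0 : x != 0 by near: x; exact: (@nbhs_dnbhs_neq R 0).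
have ax : pseries a x @ \oo --> F x by near: x.
have -> : pseries (fun n => a n.+1) x =
    (fun n => (pseries a x n.+1 - a 0%N) / x).
  apply/funext => n; rewrite /pseries /series/= big_nat_recl// expr0 mulr1.
  rewrite addrAC subrr add0r.
  rewrite mulr_suml; apply: eq_bigr => i _.
  by rewrite exprSr mulrA mulfK.
apply: cvgMr_tmp.
apply: cvgB; last exact: cvg_cst.
by move: ax; rewrite -(cvg_shiftS (pseries a x)).
Unshelve. all: by end_near. Qed.

(** The constant coefficient is the limit of the sum at 0; the others follow by
    dividing the series by [x]. *)
Lemma has_gf0_coef a : has_gf a (fun=> 0) -> forall n, a n = 0.
Proof.
move=> a0 n; elim: n a a0 => [|n IHn] a a0.
  have := has_gf_at0 a0; move/cvg_unique; apply => //.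
  exact: cvg_cst.
have a00 : a 0%N = 0.
  have := has_gf_at0 a0; move/cvg_unique; apply => //.
  exact: cvg_cst.
apply: (IHn (fun n => a n.+1)).
apply: has_gf_near (has_gf_shift a0).
by near=> x; rewrite a00 subrr mul0r.
Unshelve. all: by end_near. Qed.

Lemma has_gf_inj a b F : has_gf a F -> has_gf b F -> a =1 b.
Proof.
move=> aF bF n; apply/eqP; rewrite -subr_eq0; apply/eqP.
apply: (@has_gf0_coef (fun n => a n - b n)).
have := has_gfD aF (has_gfZ (- 1) bF).
under eq_fun do rewrite mulN1r.
by apply: has_gf_near; near=> x; rewrite mulN1r subrr.
Unshelve. all: by end_near. Qed.

(** The truncations are polynomials of degree less than [N]; the coefficients of
    their product agree with the Cauchy product below [N], and its [n]-th
    coefficient is at most [(n + 1) * K * L * r ^ n <= K * L * (2 * r) ^ n]. *)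
Lemma pseries_prod_tail a b (K L r x : R) N : 0 <= r -> 2 * r * `|x| <= 2^-1 ->
    (forall n, `|a n| <= K * r ^+ n) -> (forall n, `|b n| <= L * r ^+ n) ->
  `|pseries a x N * pseries b x N - pseries (fps_mul a b) x N|
    <= 2 * (K * L) * (2 * r * `|x|) ^+ N.
Proof.
move=> r0 z2 aK bL.
have K0 : 0 <= K by have := aK 0%N; rewrite expr0 mulr1; exact: le_trans.
have L0 : 0 <= L by have := bL 0%N; rewrite expr0 mulr1; exact: le_trans.
pose A := \poly_(i < N) a i; pose B := \poly_(i < N) b i.
have hA : pseries a x N = A.[x].
  by rewrite horner_poly /pseries /series/= big_mkord.
have hB : pseries b x N = B.[x].
  by rewrite horner_poly /pseries /series/= big_mkord.
have sAB : (size (A * B)%R <= N + N)%N.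
  apply: leq_trans (size_polyMleq _ _) _.
  by apply: leq_trans (leq_pred _) _; rewrite leq_add// size_poly.
have cA n : `|A`_n| <= K * r ^+ n.
  rewrite coef_poly; case: ifP => // _; rewrite normr0.
  by rewrite mulr_ge0// exprn_ge0.
have cB n : `|B`_n| <= L * r ^+ n.
  rewrite coef_poly; case: ifP => // _; rewrite normr0.
  by rewrite mulr_ge0// exprn_ge0.
have cAB n : `|(A * B)`_n * x ^+ n| <= K * L * (2 * r * `|x|) ^+ n.
  rewrite normrM normrX exprMn mulrA; apply: ler_wpM2r; first exact: exprn_ge0.
  rewrite coefM; apply: le_trans (ler_norm_sum _ _ _) _.
  have -> : K * L * (2 * r) ^+ n = 2 ^+ n * (K * L * r ^+ n).
    by rewrite exprMn; ring.
  apply: (@le_trans _ _ (\sum_(j < n.+1) K * L * r ^+ n)).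
    apply: ler_sum => j _; rewrite normrM.
    apply: le_trans (ler_pM _ _ (cA _) (cB _)) _ => //.
    rewrite mulrACA -exprD subnKC// -ltnS; exact: ltn_ord.
  rewrite sumr_const card_ord -[leLHS]mulr_natl; apply: ler_wpM2r.
    by rewrite !mulr_ge0 ?exprn_ge0.
  by rewrite -natrX ler_nat ltn_expl.
have -> : pseries (fps_mul a b) x N = \sum_(0 <= n < N) (A * B)`_n * x ^+ n.
  rewrite /pseries /series/=; apply: eq_big_nat => n /andP[_ nN].
  rewrite coefM; congr (_ * _); apply: eq_bigr => j _.
  rewrite !coef_poly (leq_ltn_trans _ nN); last by rewrite -ltnS ltn_ord.
  by rewrite (leq_ltn_trans (leq_subr _ _) nN).
rewrite hA hB -hornerM (horner_coef_wide _ sAB).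
rewrite -(big_mkord xpredT (fun n => (A * B)`_n * x ^+ n)).
rewrite (big_cat_nat _ (leq_addr N N))//= addrAC subrr add0r.
apply: (geometric_tail N (N + N) _ cAB).
by rewrite z2 !mulr_ge0.
Qed.

Lemma has_gfM a b F G : has_gf a F -> has_gf b G ->
  has_gf (fps_mul a b) (fun x => F x * G x).
Proof.
move=> aF bG.
have [K K0 [r1 r10 aK]] := has_gf_growth aF.
have [L L0 [r2 r20 bL]] := has_gf_growth bG.
pose r := r1 + r2; have r0 : 0 < r by rewrite addr_gt0.
have {}aK n : `|a n| <= K * r ^+ n.
  apply: le_trans (aK n) _; rewrite ler_wpM2l// lerXn2r ?nnegrE ?ltW//.
  by rewrite ltrDl.
have {}bL n : `|b n| <= L * r ^+ n.
  apply: le_trans (bL n) _; rewrite ler_wpM2l// lerXn2r ?nnegrE ?ltW//.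
  by rewrite ltrDr.
have e0 : 0 < 2^-1 / (2 * r) by rewrite divr_gt0 ?invr_gt0 ?mulr_gt0.
rewrite /has_gf; near=> x.
have ax : pseries a x @ \oo --> F x by near: x.
have bx : pseries b x @ \oo --> G x by near: x.
have z2 : 2 * r * `|x| <= 2^-1.
  rewrite mulrC -ler_pdivlMr ?mulr_gt0//; near: x; exact: dnbhs0_le.
pose z := 2 * r * `|x|.
have z0 : 0 <= z by rewrite /z !mulr_ge0// ltW.
have zN : 2 * (K * L) * z ^+ N @[N --> \oo] --> (0 : R).
  rewrite -[X in _ --> X](mulr0 (2 * (K * L))); apply: cvgMl_tmp.
  by apply: cvg_expr; rewrite ger0_norm// (le_lt_trans z2)// invf_lt1// ltr1n.
have tail : pseries a x N * pseries b x N - pseries (fps_mul a b) x N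
    @[N --> \oo] --> (0 : R).
  apply/norm_cvg0P; apply: squeeze_cvgr zN; last exact: cvg_cst.
  near=> N; rewrite normr_ge0/=; apply: pseries_prod_tail => //; exact: ltW.
have -> : pseries (fps_mul a b) x = (fun N => pseries a x N * pseries b x N -
    (pseries a x N * pseries b x N - pseries (fps_mul a b) x N)).
  by apply/funext => N; rewrite subKr.
rewrite -[F x * G x]subr0; exact: cvgB (cvgM ax bx) tail.
Unshelve. all: by end_near. Qed.

Lemma has_gf_one : has_gf (fps_one R) (fun=> 1).
Proof.
rewrite /has_gf; near=> x.
apply: cvg_near_cst; near=> n.
have n0 : (0 < n)%N by near: n; exact: nbhs_infty_gt.
rewrite /pseries /series/= big_ltn// big1_seq ?addr0 ?mul1r ?expr0//.
  move=> i /=; rewrite mem_index_iota => /andP[i0 _].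
  by rewrite /fps_one gtn_eqF// mul0r.
Unshelve. all: by end_near. Qed.

Lemma has_gf_X : has_gf (fps_X R) id.
Proof.
rewrite /has_gf; near=> x.
apply: cvg_near_cst; near=> n.
have n1 : (1 < n)%N by near: n; exact: nbhs_infty_gt.
rewrite /pseries /series/= big_ltn 1?ltnW// big_ltn//.
rewrite big1_seq ?addr0 ?mul1r ?expr1 ?mul0r ?add0r//.
  move=> i /=; rewrite mem_index_iota => /andP[i0 _].
  by rewrite /fps_X gtn_eqF// mul0r.
Unshelve. all: by end_near. Qed.

End GeneratingFunctions.

(** * Generating functions of the moments *)

Section MomentSeries.
Context {R : realType}.
Implicit Types a b c x y : R.

Lemma norm_mul_affine_le c x u : `|x| * (`|c| + 4) <= 2^-1 -> u \in `[0, 1] ->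
  `|x * (c + 4 * u)| <= 2^-1.
Proof.
move=> xc; rewrite in_itv/= => /andP[u0 u1].
rewrite normrM; apply: le_trans xc; rewrite ler_wpM2l//.
by apply: le_trans (ler_normD _ _) _; rewrite lerD2l ger0_norm; lra.
Qed.

Lemma resolvent_denom_neq0 c x u : `|x| * (`|c| + 4) <= 2^-1 ->
  u \in `[0, 1] -> 1 - x * (c + 4 * u) != 0.
Proof.
move=> xc /(norm_mul_affine_le xc); rewrite ler_norml => /andP[_ h].
by rewrite gt_eqF//; lra.
Qed.

Section Shape.
Variables (a b : R) (a0 : 0 < a) (b0 : 0 < b).

(** Binomial theorem for [((c + 4 * u) + 1) ^ n] under the integral. *)
Lemma moment_translate1 c n :
  moment (c + 1) a b n = binomial_transform (moment c a b) n.
Proof.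
rewrite momentE// /binomial_transform.
under eq_bigr do rewrite momentE//.
have cE j : {in `[0, 1], continuous (fun u : R => (c + 4 * u) ^+ j)}.
  by move=> u _; exact: continuous_affine_exp.
under eq_bigr do rewrite -beta_meanZ//.
rewrite -(@beta_mean_sum _ _ _ a0 b0
  (fun j u => 'C(n, j)%:R * (c + 4 * u) ^+ j) n.+1).
  apply: eq_beta_mean => u _; rewrite addrAC exprD1n.
  by apply: eq_bigr => j _; rewrite [RHS]mulr_natl.
by move=> j u u01; apply: cvgMl_tmp; exact: cE.
Qed.

(** The partial sums are expectations of truncated geometric series in
    [x * (c + 4 * u)], which is at most [1 / 2] in absolute value, so the
    remainders are uniformly at most [2 / 2 ^ N]. *)
Lemma moment_pseries c x : `|x| * (`|c| + 4) <= 2^-1 ->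
  pseries (moment c a b) x @ \oo -->
  beta_mean a b (fun u => (1 - x * (c + 4 * u))^-1).
Proof.
move=> xc.
have q2 u : u \in `[0, 1] -> `|x * (c + 4 * u)| <= 2^-1.
  exact: norm_mul_affine_le.
have d0 u : u \in `[0, 1] -> 2^-1 <= 1 - x * (c + 4 * u).
  by move=> /q2; rewrite ler_norml => /andP[_]; lra.
pose g u := (1 - x * (c + 4 * u))^-1.
have cg : {in `[0, 1], continuous g}.
  move=> u u01; apply: continuous_resolvent; exact: resolvent_denom_neq0.
pose F n u := x ^+ n * (c + 4 * u) ^+ n.
have cF n : {in `[0, 1], continuous (F n)}.
  by move=> u u01; apply: cvgMl_tmp; exact: continuous_affine_exp.
have cS N : {in `[0, 1], continuous (fun u => \sum_(n < N) F n u)}.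
  exact: continuous_sum_in.
have serE N : pseries (moment c a b) x N =
    beta_mean a b (fun u => \sum_(n < N) F n u).
  rewrite beta_mean_sum// /pseries /series/= big_mkord; apply: eq_bigr => n _.
  rewrite momentE// /F beta_meanZ// 1?mulrC//.
  by move=> u _; exact: continuous_affine_exp.
have tail N : `|beta_mean a b g - pseries (moment c a b) x N| <= 2 * 2^-1 ^+ N.
  rewrite serE.
  have -> : beta_mean a b g - beta_mean a b (fun u => \sum_(n < N) F n u) =
      beta_mean a b (fun u => g u + -1 * \sum_(n < N) F n u).
    rewrite beta_meanD//; first by rewrite beta_meanZ// mulN1r.
    by move=> u u01; apply: cvgMl_tmp; exact: cS.
  apply: beta_mean_le => //.
    move=> u u01; apply: cvgD; first exact: cg.
    by apply: cvgMl_tmp; exact: cS.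
  move=> u u01; set q := x * (c + 4 * u).
  have -> : g u + -1 * \sum_(n < N) F n u = q ^+ N * (1 - q)^-1.
    have q1 : 1 - q != 0 by exact: resolvent_denom_neq0.
    have -> : \sum_(n < N) F n u = \sum_(n < N) q ^+ n.
      by apply: eq_bigr => n _; rewrite /F exprMn.
    apply: (mulIf q1); rewrite divfK// /g -/q mulrDl mulVf//.
    by rewrite -[q ^+ N in RHS](subrK 1) subrX1; ring.
  rewrite mulrC normrM normfV normrX.
  have := d0 _ u01; have := q2 _ u01; rewrite -/q => q2u d0u.
  apply: ler_pM => //; rewrite ?invr_ge0//.
  - rewrite -[leRHS]invrK lef_pV2 ?posrE ?normr_gt0 ?invr_gt0//.
      by rewrite (le_trans d0u)// ler_norm.
    by rewrite gt_eqF// (lt_le_trans _ d0u)// invr_gt0.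
  - by rewrite lerXn2r ?nnegrE.
apply/cvgrPdist_le => e e0; near=> N.
apply: le_trans (tail N) _; near: N.
have h : 2 * 2^-1 ^+ N @[N --> \oo] --> (0 : R).
  rewrite -[X in _ --> X](mulr0 2); apply: cvgMl_tmp.
  by apply: cvg_expr; rewrite ger0_norm// invf_lt1// ltr1n.
exact: (cvgr_le _ h e e0).
Unshelve. all: by end_near. Qed.

Lemma near_mul_norm_le (k : R) :
  \forall x \near (0 : R)^', `|x| * (`|k| + 4) <= 2^-1.
Proof.
near=> x; rewrite -ler_pdivlMr ?ltr_wpDl//; near: x; apply: dnbhs0_le.
by rewrite divr_gt0 ?invr_gt0 ?ltr_wpDl.
Unshelve. all: by end_near. Qed.

Lemma has_gf_moment c : has_gf (moment c a b)
  (fun x => beta_mean a b (fun u => (1 - x * (c + 4 * u))^-1)).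
Proof.
rewrite /has_gf; near=> x; apply: moment_pseries.
by near: x; exact: near_mul_norm_le.
Unshelve. all: by end_near. Qed.

Lemma near_onem_mul_gt0 c : \forall x \near (0 : R)^', 0 < 1 - c * x.
Proof.
near=> x; have : `|x| * (`|c| + 4) <= 2^-1 by near: x; exact: near_mul_norm_le.
rewrite mulrDr => h.
have : `|c * x| <= 2^-1.
  by rewrite normrM mulrC; have := normr_ge0 x; lra.
by rewrite ler_norml => /andP[_]; lra.
Unshelve. all: by end_near. Qed.

(** Lets properties that hold near 0 be used at [x / (1 - c * x)]. *)
Lemma moebius_dnbhs0 c : x / (1 - c * x) @[x --> (0 : R)^'] --> (0 : R)^'.
Proof.
apply: cvg_dnbhs0.
  have id0 : x @[x --> (0 : R)^'] --> (0 : R) by exact: (@nbhs_dnbhs R 0).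
  rewrite -[X in _ --> X](mul0r (1 - c * 0)^-1); apply: cvgM => //.
  apply: cvgV; first by rewrite mulr0 subr0.
  by apply: cvgB; [exact: cvg_cst|exact: cvgMl_tmp id0].
near=> x; rewrite mulf_neq0// ?invr_neq0//.
  by near: x; exact: (@nbhs_dnbhs_neq R 0).
by rewrite gt_eqF//; near: x; exact: near_onem_mul_gt0.
Unshelve. all: by end_near. Qed.

(** From [1 - x * (c + 4 * u) = (1 - c * x) * (1 - y * (4 * u))] with
    [y = x / (1 - c * x)]. *)
Lemma has_gf_moment_translate c (F : R -> R) : has_gf (moment 0 a b) F ->
  has_gf (moment c a b) (fun x => (1 - c * x)^-1 * F (x / (1 - c * x))).
Proof.
move=> /(has_gf_fun_unique (has_gf_moment 0)) E.
have small : \forall x \near (0 : R)^',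
    `|x / (1 - c * x)| * (`|0 : R| + 4) <= 2^-1.
  by have := moebius_dnbhs0 c (near_mul_norm_le 0); apply.
apply: has_gf_near (has_gf_moment c); near=> x.
have <- : beta_mean a b (fun u => (1 - x / (1 - c * x) * (0 + 4 * u))^-1) =
    F (x / (1 - c * x)).
  by near: x; exact: moebius_dnbhs0 E.
have xc : `|x| * (`|c| + 4) <= 2^-1 by near: x; exact: near_mul_norm_le.
have cx : 0 < 1 - c * x by near: x; exact: near_onem_mul_gt0.
have y4 : `|x / (1 - c * x)| * (`|0 : R| + 4) <= 2^-1.
  by near: x.
rewrite -beta_meanZ//.
  apply: eq_beta_mean => u u01.
  by rewrite -invfM; congr (_^-1); field; rewrite gt_eqF.
move=> u u01; apply: continuous_resolvent.
exact: resolvent_denom_neq0.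
Unshelve. all: by end_near. Qed.

Lemma moment00 : moment 0 a b 0 = 1.
Proof. by rewrite momentE// -(beta_mean_exp0 a0 b0); apply: eq_beta_mean. Qed.

Lemma moment0S n :
  moment 0 a b n.+1 = 4 * (a + n%:R) / (a + b + n%:R) * moment 0 a b n.
Proof.
have mE m : moment 0 a b m = 4 ^+ m * beta_mean a b (fun u => u ^+ m).
  rewrite momentE// -beta_meanZ//.
    by apply: eq_beta_mean => u _; rewrite add0r exprMn.
  by move=> u _; exact: exprn_continuous.
by rewrite !mE beta_mean_expS// exprS; ring.
Qed.

End Shape.

End MomentSeries.

(** * Catalan numbers *)

Section Catalan.
Context {R : realType}.
Implicit Types x c : R.

Lemma central_binomS n :
  (n.+1 * 'C(2 * n.+1, n.+1) = 2 * (2 * n).+1 * 'C(2 * n, n))%N.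
Proof.
have e : (2 * n.+1 = (2 * n).+2)%N by rewrite mulnS.
have h1 := mul_bin_diag (2 * n).+2 n.
have h2 := mul_bin_down (2 * n).+1 n.
rewrite /= in h1 h2.
have h3 : ((2 * n).+1 - n = n.+1)%N by rewrite mul2n -addnn -addSn addnK.
rewrite h3 in h2.
by rewrite e -h1 -mulnA h2 mulnA e.
Qed.

Lemma central_binomS_ring n :
  (n%:R + 1) * 'C(2 * n.+1, n.+1)%:R =
  2 * (2 * n%:R + 1) * 'C(2 * n, n)%:R :> R.
Proof.
have := congr1 (fun m => m%:R : R) (central_binomS n).
by rewrite !natrM -(natr1 n) -(natr1 (2 * n)) natrM.
Qed.

Lemma catalan0 : catalan R 0 = 1.
Proof. by rewrite /catalan bin0 invr1 mulr1. Qed.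

Lemma catalanS n : (n%:R + 2) * catalan R n.+1 = (4 * n%:R + 2) * catalan R n.
Proof.
have n1 : n%:R + 1 != 0 :> R by rewrite natr1 pnatr_eq0.
have n2 : n%:R + 2 != 0 :> R by rewrite -natrD addn2 pnatr_eq0.
rewrite /catalan -(natr1 n.+1) -(natr1 n); apply: (mulfI n1).
have -> : n%:R + 1 + 1 = n%:R + 2 :> R by ring.
rewrite [LHS](_ : _ = (n%:R + 1) * 'C(2 * n.+1, n.+1)%:R); last by field.
by rewrite central_binomS_ring; field.
Qed.

Lemma moment0_catalan n : moment (0 : R) (1 / 2) (3 / 2) n = catalan R n.
Proof.
have [a0 b0] : 0 < 1 / 2 :> R /\ 0 < 3 / 2 :> R by split; lra.
elim: n => [|n IHn]; first by rewrite moment00// catalan0.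
rewrite moment0S// IHn.
have n2 : n%:R + 2 != 0 :> R by rewrite -natrD addn2 pnatr_eq0.
apply: (mulfI n2); rewrite catalanS.
have -> : 1 / 2 + 3 / 2 + n%:R = n%:R + 2 :> R by lra.
by field.
Qed.

Lemma moment0_catalanS n : moment (0 : R) (3 / 2) (3 / 2) n = catalan R n.+1.
Proof.
have a0 : 0 < 3 / 2 :> R by lra.
elim: n => [|n IHn].
  by have := catalanS 0; rewrite moment00// catalan0; lra.
rewrite moment0S// IHn.
have n3 : n.+1%:R + 2 != 0 :> R by rewrite -natrD addn2 pnatr_eq0.
apply: (mulfI n3); rewrite catalanS -natr1.
rewrite -natr1 in n3.
have -> : 3 / 2 + 3 / 2 + n%:R = n%:R + 1 + 2 :> R by lra.
by field.
Qed.

(** ['C(2 n + 1, n + 1)] is half of the next central binomial coefficient. *)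
Lemma moment0_odd_binom n :
  moment (0 : R) (3 / 2) (1 / 2) n = 'C(2 * n + 1, n + 1)%:R.
Proof.
have [a0 b0] : 0 < 3 / 2 :> R /\ 0 < 1 / 2 :> R by split; lra.
have odd_central m : 2 * 'C(2 * m + 1, m + 1)%:R = 'C(2 * m.+1, m.+1)%:R :> R.
  rewrite !addn1 mulnS add2n [in RHS]binS.
  have -> : 'C((2 * m).+1, m) = 'C((2 * m).+1, m.+1).
    have le : (m <= (2 * m).+1)%N by rewrite mul2n -addnn leqW// leq_addr.
    by rewrite -(bin_sub le) mul2n -addnn -addSn addnK.
  by rewrite natrD; ring.
elim: n => [|n IHn]; first by rewrite moment00// bin1.
rewrite moment0S// IHn; apply: (@mulfI _ 2) => //.
rewrite mulrCA !odd_central.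
have n2 : n.+1%:R + 1 != 0 :> R by rewrite natr1 pnatr_eq0.
apply: (mulfI n2); rewrite central_binomS_ring -(natr1 n).
rewrite -(natr1 n) in n2.
have -> : 3 / 2 + 1 / 2 + n%:R = n%:R + 1 + 1 :> R by lra.
by field.
Qed.

(** By induction, without generating functions.  Weighting the terms of the
    convolution [S m] by [k + 1] gives [W m], and the symmetry [k <-> m - k]
    gives [2 * W m = (m + 2) * S m].  The recurrence [catalanS] expresses
    [W m.+1] by [W m] and [S m], whence a recurrence for [S] alone, which the
    shifted Catalan numbers satisfy too. *)
Lemma catalan_convolution n :
  fps_mul (catalan R) (catalan R) n = catalan R n.+1.
Proof.
pose C := catalan R; pose S m := \sum_(k < m.+1) C k * C (m - k)%N.
pose W m := \sum_(k < m.+1) (k%:R + 1) * (C k * C (m - k)%N).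
have WS m : 2 * W m = (m%:R + 2) * S m.
  have -> : 2 * W m =
      W m + \sum_(k < m.+1) ((m - k)%N%:R + 1) * (C k * C (m - k)%N).
    rewrite mulr_natl mulr2n; congr (_ + _).
    rewrite /W (reindex_inj rev_ord_inj)/=; apply: eq_bigr => k _.
    by rewrite subSS subKn ?leq_ord// [C _ * _]mulrC.
  rewrite -big_split mulr_sumr; apply: eq_bigr => k _.
  rewrite /= -mulrDl natrB ?leq_ord//; congr (_ * _); ring.
have WSS m : W m.+1 = C m.+1 + 4 * W m - 2 * S m.
  rewrite /W big_ord_recl subn0 add0r /C catalan0 !mul1r -addrA; congr (_ + _).
  rewrite !mulr_sumr -sumrB; apply: eq_bigr => k _.
  have := catalanS k; rewrite -/C => Ck.
  rewrite lift0 subSS -natr1 (_ : k%:R + 1 + 1 = k%:R + 2) 1?mulrA ?Ck; ring.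
have SS m : (m%:R + 3) * S m.+1 = 2 * C m.+1 + (4 * m%:R + 4) * S m.
  have := WS m.+1; rewrite WSS -natr1; have := WS m; lra.
elim: n => [|n IHn].
  rewrite /fps_mul big_ord_recl big_ord0 subn0 catalan0.
  by have := catalanS 0; rewrite catalan0; lra.
have n3 : n%:R + 3 != 0 :> R by rewrite -natrD addn3 pnatr_eq0.
apply: (mulfI n3); rewrite -/(S n.+1) SS [S n]IHn -/C.
have := catalanS n.+1; rewrite -natr1 -/C => h.
have -> : (n%:R + 3) * C n.+2 = (n%:R + 1 + 2) * C n.+2 by ring.
rewrite h; ring.
Qed.

Definition catalan_gf x : R := (1 - Num.sqrt (1 - 4 * x)) / (2 * x).

(** That the series converges near 0 is known from its expression as a moment
    generating function [F]. *)
Lemma has_gf_catalan : has_gf (catalan R) catalan_gf.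
Proof.
have [a0 b0] : 0 < 1 / 2 :> R /\ 0 < 3 / 2 :> R by split; lra.
pose F x := beta_mean (1 / 2) (3 / 2) (fun u => (1 - x * (0 + 4 * u))^-1).
have CF : has_gf (catalan R) F.
  by apply: eq_has_gf (has_gf_moment a0 b0 0) => n; rewrite moment0_catalan.
have quad : \forall x \near (0 : R)^', F x * F x = (F x - catalan R 0) / x.
  apply: has_gf_fun_unique (has_gf_shift CF).
  by apply: eq_has_gf (has_gfM CF CF); exact: catalan_convolution.
have small : \forall x \near (0 : R)^', x * F x < 2^-1.
  have id0 : x @[x --> (0 : R)^'] --> (0 : R) by exact: (@nbhs_dnbhs R 0).
  have h : x * F x @[x --> (0 : R)^'] --> (0 : R).
    rewrite -[X in _ --> X](mul0r (catalan R 0)).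
    by apply: cvgM => //; exact: has_gf_at0.
  have half0 : 0 < 2^-1 :> R by rewrite invr_gt0.
  exact: (cvgr_lt _ h _ half0).
apply: has_gf_near CF; near=> x.
have x0 : x != 0 by near: x; exact: (@nbhs_dnbhs_neq R 0).
have xF : x * F x < 2^-1 by near: x.
have qF : x * (F x * F x) = F x - 1.
  have -> : F x * F x = (F x - catalan R 0) / x by near: x.
  by rewrite catalan0 mulrC divfK.
rewrite /catalan_gf; have -> : 1 - 4 * x = (1 - 2 * (x * F x)) ^+ 2.
  rewrite (_ : (1 - _) ^+ 2 = 1 - 4 * x * F x + 4 * x * (x * (F x * F x)));
    last by ring.
  by rewrite qF; ring.
rewrite sqrtr_sqr ger0_norm; last by lra.
by field.
Unshelve. all: by end_near. Qed.

End Catalan.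

(** * Closed forms and the Motzkin equation *)

Section ClosedForms.
Context {R : realType}.
Implicit Types x c : R.

Lemma near0_neq0 : \forall x \near (0 : R)^', x != 0.
Proof. exact: (@nbhs_dnbhs_neq R 0). Qed.

Lemma has_gf_moment_half c : has_gf (moment c (1 / 2) (3 / 2))
  (fun x => (1 - Num.sqrt ((1 - (4 + c) * x) / (1 - c * x))) / (2 * x)).
Proof.
have [a0 b0] : 0 < 1 / 2 :> R /\ 0 < 3 / 2 :> R by split; lra.
have M0 : has_gf (moment 0 (1 / 2) (3 / 2)) (@catalan_gf R).
  by apply: eq_has_gf has_gf_catalan => n; rewrite moment0_catalan.
apply: has_gf_near (has_gf_moment_translate a0 b0 c M0); near=> x.
have x0 : x != 0 by near: x; exact: near0_neq0.
have cx : 1 - c * x != 0.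
  by rewrite gt_eqF//; near: x; exact: near_onem_mul_gt0.
rewrite /catalan_gf.
have -> : 1 - 4 * (x / (1 - c * x)) = (1 - (4 + c) * x) / (1 - c * x).
  by field.
by field; rewrite x0 cx.
Unshelve. all: by end_near. Qed.

Lemma has_gf_scaled_moment_half c :
  has_gf (fun n => 2 ^+ n * moment c (1 / 2) (3 / 2) n)
    (fun x =>
      (1 - Num.sqrt ((1 - 2 * (4 + c) * x) / (1 - 2 * c * x))) / (4 * x)).
Proof.
have := @has_gf_scale R 2 _ _ _ (has_gf_moment_half c); rewrite pnatr_eq0.
move=> /(_ isT); apply: has_gf_near; near=> x.
have -> : (4 + c) * (2 * x) = 2 * (4 + c) * x by ring.
have -> : c * (2 * x) = 2 * c * x by ring.
by have -> : 2 * (2 * x) = 4 * x by ring.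
Unshelve. all: by end_near. Qed.

Lemma has_gf_adjoin1 (a : R^nat) (F : R -> R) : has_gf a F ->
  has_gf (adjoin1 a) (fun x => 1 + x * F x).
Proof.
move=> aF; rewrite /has_gf; near=> x.
have ax : pseries a x @ \oo --> F x by near: x.
rewrite -cvg_shiftS.
have -> : (fun n => pseries (adjoin1 a) x n.+1) =
    (fun n => 1 + x * pseries a x n).
  apply/funext => n; rewrite /pseries /series/= big_nat_recl// expr0 mulr1.
  congr (_ + _); rewrite mulr_sumr; apply: eq_bigr => i _.
  by rewrite /= exprS mulrCA.
by apply: cvgD; [exact: cvg_cst|exact: cvgMl_tmp ax].
Unshelve. all: by end_near. Qed.

Definition motzkin_gf x : R :=
  (1 - x - Num.sqrt (1 - 2 * x - 3 * x ^+ 2)) / (2 * x ^+ 2).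

Lemma near_motzkin_disc_ge0 :
  \forall x \near (0 : R)^', 0 <= 1 - 2 * x - 3 * x ^+ 2.
Proof.
near=> x; have h1 : 0 < 1 - -1 * x by near: x; exact: near_onem_mul_gt0.
have h3 : 0 < 1 - 3 * x by near: x; exact: near_onem_mul_gt0.
have -> : 1 - 2 * x - 3 * x ^+ 2 = (1 - -1 * x) * (1 - 3 * x) by ring.
by rewrite mulr_ge0 ?ltW.
Unshelve. all: by end_near. Qed.

(** The series of the shifted Catalan numbers is the Catalan series minus 1,
    divided by [x]; translate it by [c = -1]. *)
Lemma has_gf_moment_motzkin : has_gf (moment (-1) (3 / 2) (3 / 2)) motzkin_gf.
Proof.
have a0 : 0 < 3 / 2 :> R by lra.
have M0 : has_gf (moment 0 (3 / 2) (3 / 2))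
    (fun x => (@catalan_gf R x - 1) / x).
  have := has_gf_shift (@has_gf_catalan R); rewrite catalan0.
  by apply: eq_has_gf => n; rewrite moment0_catalanS.
apply: has_gf_near (has_gf_moment_translate a0 a0 (-1) M0); near=> x.
have x0 : x != 0 by near: x; exact: near0_neq0.
have cx : 0 < 1 - -1 * x by near: x; exact: near_onem_mul_gt0.
have cx0 : 1 - -1 * x != 0 by rewrite gt_eqF.
rewrite /catalan_gf /motzkin_gf.
have -> : 1 - 2 * x - 3 * x ^+ 2 =
    (1 - -1 * x) ^+ 2 * (1 - 4 * (x / (1 - -1 * x))) by field.
rewrite sqrtrM ?sqr_ge0// sqrtr_sqr gtr0_norm//.
by field; rewrite x0 cx0.
Unshelve. all: by end_near. Qed.

Lemma motzkin_gf_quadratic : \forall x \near (0 : R)^',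
  x ^+ 2 * motzkin_gf x ^+ 2 + (x - 1) * motzkin_gf x + 1 = 0.
Proof.
near=> x.
have x0 : x != 0 by near: x; exact: near0_neq0.
have d0 : 0 <= 1 - 2 * x - 3 * x ^+ 2 by near: x; exact: near_motzkin_disc_ge0.
rewrite /motzkin_gf; have := sqr_sqrtr d0; set s := Num.sqrt _ => s2.
rewrite [LHS](_ : _ = (s ^+ 2 - (1 - 2 * x - 3 * x ^+ 2)) / (4 * x ^+ 2)).
  by rewrite s2 subrr mul0r.
by field.
Unshelve. all: by end_near. Qed.

Lemma fps_mul_Xn (d : nat) (h : R^nat) n :
  fps_mul (fun k => (k == d)%:R) h n = if (d <= n)%N then h (n - d)%N else 0.
Proof.
rewrite /fps_mul; case: leqP => dn.
  rewrite (bigD1 (Ordinal (dn : (d < n.+1)%N)))//= eqxx mul1r.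
  rewrite big1 ?addr0// => k kd.
  by rewrite -val_eqE/= in kd; rewrite (negPf kd) mul0r.
rewrite big1// => k _; rewrite ltn_eqF ?mul0r//.
by rewrite (leq_trans _ dn)// ltn_ord.
Qed.

Lemma fps_XX : fps_mul (fps_X R) (fps_X R) = (fun k => (k == 2%N)%:R).
Proof.
apply/funext => k; rewrite fps_mul_Xn /fps_X.
by case: k => [|[|[|k]]].
Qed.

Lemma motzkin_series_rec (f : R^nat) n : motzkin_series f ->
  f n = (n == 0%N)%:R + (if (1 <= n)%N then f (n - 1)%N else 0)
      + (if (2 <= n)%N then fps_mul f f (n - 2)%N else 0).
Proof.
move=> /(_ n); rewrite fps_XX fps_mul_Xn.
have -> : fps_mul (fun k => fps_X R k - fps_one R k) f n =
    fps_mul (fps_X R) f n - fps_mul (fps_one R) f n.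
  by rewrite /fps_mul -sumrB; apply: eq_bigr => k _; rewrite mulrBl.
rewrite !fps_mul_Xn leq0n subn0 /fps_one; lra.
Qed.

(** The equation expresses the [n]-th coefficient by the previous ones. *)
Lemma motzkin_series_unique (f g : R^nat) :
  motzkin_series f -> motzkin_series g -> f =1 g.
Proof.
move=> fM gM n; elim/ltn_ind: n => n IHn.
rewrite (motzkin_series_rec n fM) (motzkin_series_rec n gM).
congr (_ + _ + _); case: ifP => // n0.
  by apply: IHn; rewrite subn1 ltn_predL.
apply: eq_bigr => k _; have kn := ltn_ord k.
have n2 : (n - 2 < n)%N by rewrite ltn_subrL (ltn_trans _ n0).
by congr (_ * _); apply: IHn;
  [exact: leq_trans kn n2|exact: leq_ltn_trans (leq_subr _ _) n2].
Qed.

(** The coefficients of the left-hand side are those of a function that vanishes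
    near 0 by [motzkin_gf_quadratic]. *)
Lemma motzkin_series_moment : motzkin_series (moment (-1 : R) (3 / 2) (3 / 2)).
Proof.
pose M := moment (-1 : R) (3 / 2) (3 / 2).
have MF : has_gf M motzkin_gf by exact: has_gf_moment_motzkin.
have X1 : has_gf (fun k => fps_X R k - fps_one R k) (fun x => x - 1).
  apply: has_gf_near (eq_has_gf _
    (has_gfD (@has_gf_X R) (has_gfZ (- 1) (@has_gf_one R)))).
    by near=> x; rewrite mulr1.
  by move=> k; rewrite mulN1r.
have XX := has_gfM (@has_gf_X R) (@has_gf_X R).
have lhs := has_gfD
  (has_gfD (has_gfM XX (has_gfM MF MF)) (has_gfM X1 MF)) (@has_gf_one R).
have lhs0 := has_gf_near _ lhs (G := fun=> 0).
rewrite /motzkin_series /=; apply: has_gf0_coef; apply: lhs0; near=> x.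
rewrite -!expr2; near: x; exact: motzkin_gf_quadratic.
Unshelve. all: by end_near. Qed.

Lemma riordan_moment n : moment (-1 : R) (1 / 2) (3 / 2) n = riordan R n.
Proof.
have h := has_gf_moment_half (-1).
have {}h : has_gf (moment (-1) (1 / 2) (3 / 2))
    (fun x : R => (1 - Num.sqrt ((1 - 3 * x) / (1 + x))) / (2 * x)).
  apply: has_gf_near h; near=> x.
  have -> : (4 + -1) * x = 3 * x by ring.
  by rewrite mulN1r opprK.
have rh := @getI _ [set r : R^nat | has_gf r _] _ h.
exact: (has_gf_inj h rh).
Unshelve. all: by end_near. Qed.

Lemma motzkin_moment n : moment (-1 : R) (3 / 2) (3 / 2) n = motzkin R n.
Proof.
apply: motzkin_series_unique; first exact: motzkin_series_moment.
exact: (@getI _ [set f : R^nat | motzkin_series f] _ motzkin_series_moment).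
Qed.

End ClosedForms.

Theorem corollary3 (R : realType) :
  (* 1 *)
  (has_gf (moment (-1 : R) (1 / 2) (3 / 2))
     (fun x => (1 - Num.sqrt ((1 - 3 * x) / (1 + x))) / (2 * x)) /\
   forall n, moment (-1 : R) (1 / 2) (3 / 2) n = riordan R n) /\
  (* 2 *)
  (let f := fun x : R =>
     (1 - x - Num.sqrt (1 - 2 * x - 3 * x ^+ 2)) / (2 * x ^+ 2) in
   [/\ has_gf (moment (-1) (3 / 2) (3 / 2)) f,
       \forall x \near 0^', x ^+ 2 * f x ^+ 2 + (x - 1) * f x + 1 = 0,
       motzkin_series (moment (-1 : R) (3 / 2) (3 / 2)) &
       forall n, moment (-1) (3 / 2) (3 / 2) n = motzkin R n]) /\
  (* 3 *)
  (let A := fun x : R =>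
     (1 - Num.sqrt ((1 - 7 * x) / (1 + x))) / (4 * x) in
   has_gf (fun n => 2 ^+ n * moment (- (1 / 2)) (1 / 2) (3 / 2) n) A /\
   \forall x \near 0^', A x = 1 / (1 + x) + 2 * x * A x ^+ 2) /\
  (* 4 *)
  has_gf (fun n => 2 ^+ n * moment (- (3 / 2) : R) (1 / 2) (3 / 2) n)
    (fun x => (1 - Num.sqrt ((1 - 5 * x) / (1 + 3 * x))) / (4 * x)) /\
  (* 5 *)
  (has_gf (fun n => 2 ^+ n * moment (1 / 2 : R) (1 / 2) (3 / 2) n)
     (fun x => (1 - Num.sqrt ((1 - 9 * x) / (1 - x))) / (4 * x)) /\
   has_gf (adjoin1 (fun n => 2 ^+ n * moment (1 / 2 : R) (1 / 2) (3 / 2) n))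
     (fun x => (5 - Num.sqrt ((1 - 9 * x) / (1 - x))) / 4)) /\
  (* 6 *)
  (forall n, moment (1 : R) (1 / 2) (3 / 2) n =
     binomial_transform (catalan R) n) /\
  (* 7 *)
  (forall n, moment (1 : R) (3 / 2) (1 / 2) n =
     \sum_(j < n.+1) 'C(n, j)%:R * 'C(2 * j + 1, j + 1)%:R) /\
  (* 8 *)
  has_gf (fun n => 2 ^+ n * moment (3 / 2 : R) (1 / 2) (3 / 2) n)
    (fun x => (1 - Num.sqrt ((1 - 11 * x) / (1 - 3 * x))) / (4 * x)) /\
  (* 9 *)
  ((forall n, moment (2 : R) (1 / 2) (3 / 2) n =
      binomial_transform (binomial_transform (catalan R)) n) /\
   has_gf (moment (2 : R) (1 / 2) (3 / 2))
     (fun x => (1 - Num.sqrt ((1 - 6 * x) / (1 - 2 * x))) / (2 * x))).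
Proof.
(* The closed forms for [c = -1/2, -3/2, 1/2, 3/2] are all instances of it. *)
have half c (m n : R) : m = 2 * (4 + c) -> n = 2 * c ->
  has_gf (fun n => 2 ^+ n * moment c (1 / 2) (3 / 2) n)
    (fun x => (1 - Num.sqrt ((1 - m * x) / (1 - n * x))) / (4 * x)).
  by move=> -> ->; exact: has_gf_scaled_moment_half.
have [a0 b0] : 0 < 1 / 2 :> R /\ 0 < 3 / 2 :> R by split; lra.
have gf_ext (a : R^nat) (F G : R -> R) : has_gf a F -> F =1 G -> has_gf a G.
  by move=> aF /funext <-.
split; last split; last split; last split; last split; last split;
  last split; last split.
- split; last exact: riordan_moment.
  apply: gf_ext (has_gf_moment_half (-1)) _ => x.
  have e : 4 + -1 = 3 :> R by lra.
  by rewrite /= e mulN1r opprK.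
- split.
  + exact: has_gf_moment_motzkin.
  + exact: motzkin_gf_quadratic.
  + exact: motzkin_series_moment.
  + exact: motzkin_moment.
- split.
    apply: gf_ext (half (- (1 / 2)) 7 (- 1) _ _) _; [lra|lra|] => x.
    by rewrite /= mulN1r opprK.
  near=> x.
  have x0 : x != 0 by near: x; exact: near0_neq0.
  have h1 : 0 < 1 - -1 * x by near: x; exact: near_onem_mul_gt0.
  have h7 : 0 < 1 - 7 * x by near: x; exact: near_onem_mul_gt0.
  have {}h1 : 0 < 1 + x by lra.
  have d0 : 0 <= (1 - 7 * x) / (1 + x) by rewrite divr_ge0 ?ltW.
  have := sqr_sqrtr d0; set s := Num.sqrt _ => s2.
  have hx : 1 + x != 0 by rewrite gt_eqF.
  apply/eqP; rewrite -subr_eq0; apply/eqP.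
  rewrite [LHS](_ : _ = ((1 - 7 * x) / (1 + x) - s ^+ 2) / (8 * x)).
    by rewrite s2 subrr mul0r.
  by field; rewrite x0 hx.
- apply: gf_ext (half (- (3 / 2)) 5 (- 3) _ _) _; [lra|lra|] => x.
  by rewrite /= mulNr opprK.
- have h5 : has_gf (fun n => 2 ^+ n * moment (1 / 2 : R) (1 / 2) (3 / 2) n)
     (fun x => (1 - Num.sqrt ((1 - 9 * x) / (1 - x))) / (4 * x)).
    apply: gf_ext (half (1 / 2) 9 1 _ _) _; [lra|lra|] => x.
    by rewrite /= mul1r.
  split => //; apply: has_gf_near (has_gf_adjoin1 h5); near=> x.
  have x0 : x != 0 by near: x; exact: near0_neq0.
  by field.
- move=> n; rewrite -[X in moment X](add0r 1) moment_translate1//.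
  by congr binomial_transform; apply/funext => j; rewrite moment0_catalan.
- move=> n; rewrite -[X in moment X](add0r 1) moment_translate1//.
  by apply: eq_bigr => j _; rewrite moment0_odd_binom.
- by apply: gf_ext (half (3 / 2) 11 3 _ _) _; [lra|lra|].
- split.
    have two : 0 + 1 + 1 = 2 :> R by ring.
    move=> n; rewrite -[X in moment X]two moment_translate1//.
    congr binomial_transform; apply/funext => k.
    rewrite moment_translate1//; congr binomial_transform; apply/funext => j.
    exact: moment0_catalan.
  apply: gf_ext (has_gf_moment_half 2) _ => x.
  have e : 4 + 2 = 6 :> R by lra.
  by rewrite /= e.
Unshelve. all: by end_near. Qed.
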